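(* Let $d\ge1$, let $P,Q\in\mathbb{Z}^{d\times d}$ be invertible (over $\mathbb{Q}$) and coprime, let $\mathcal{D}\subseteq\mathbb{Z}^d+P\mathbb{Z}^d[Q^{-1}P]$ be a finite set containing a complete residue system of $(\mathbb{Z}^d+P\mathbb{Z}^d[Q^{-1}P])/P\mathbb{Z}^d[Q^{-1}P]$, let $\mathbf{d}:\mathbb{Z}^d+P\mathbb{Z}^d[Q^{-1}P]\to\mathcal{D}$ be a digit function, and let $\Phi:\mathbb{Z}^d[Q^{-1}P]\to\mathbb{Z}^d[Q^{-1}P]$, $\Phi(x)=P^{-1}(Qx-\mathbf{d}(Qx))$, be the dynamical system associated with the digit system $(P,Q,\mathcal{D})$. 1. If $\Phi$ has an attractor $\mathcal{A}_\Phi$ that is a finite set, then the digit system $(P,Q,\mathcal{D}\cup Q\mathcal{A}_\Phi)$ has the finiteness property. 2. If every eigenvalue of $Q^{-1}P$ has modulus greater than $1$, then the attractor of $\Phi$ exists and is finite.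
   Context: For $A\in\mathbb{Q}^{d\times d}$ invertible, $\mathbb{Z}^d[A]=\bigcup_{k\ge1}(\mathbb{Z}^d+A\mathbb{Z}^d+\cdots+A^{k-1}\mathbb{Z}^d)\subseteq\mathbb{Q}^d$. Invertible matrices $P,Q\in\mathbb{Z}^{d\times d}$ are coprime if $P\mathbb{Z}^d+Q\mathbb{Z}^d=\mathbb{Z}^d$. A digit function is a map $\mathbf{d}:\mathbb{Z}^d+P\mathbb{Z}^d[Q^{-1}P]\to\mathcal{D}$ with $v-\mathbf{d}(v)\in P\mathbb{Z}^d[Q^{-1}P]$ for all $v$. An attractor of $\Phi$ is a set $\mathcal{A}_\Phi\subseteq\mathbb{Z}^d[Q^{-1}P]$ such that (i) $\Phi(\mathcal{A}_\Phi)\subseteq\mathcal{A}_\Phi$; (ii) for every $x\in\mathbb{Z}^d[Q^{-1}P]$ there is $n\in\mathbb{N}$ with $\Phi^n(x)\in\mathcal{A}_\Phi$; (iii) no proper subset of $\mathcal{A}_\Phi$ satisfies (i) and (ii). It is unique if it exists. For a finite set $\mathcal{E}\subseteq\mathbb{Z}^d+P\mathbb{Z}^d[Q^{-1}P]$, the digit system $(P,Q,\mathcal{E})$ has the finiteness property if for every $x\in\mathbb{Z}^d[Q^{-1}P]$ there exist $\ell\ge 1$ and $d_0,\dots,d_{\ell-1}\in\mathcal{E}$ with $x=\sum_{i=0}^{\ell-1}(Q^{-1}P)^iQ^{-1}d_i$. Here $Q\mathcal{A}_\Phi=\{Qa: a\in\mathcal{A}_\Phi\}$. *)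

(* Defs.v *)
From mathcomp Require Import all_boot all_order all_algebra all_field.
From mathcomp Require Import mathcomp_extra boolp classical_sets functions cardinality.
Set Implicit Arguments.
Unset Strict Implicit.
Unset Printing Implicit Defensive.
Import Order.TTheory GRing.Theory Num.Theory.
Local Open Scope classical_set_scope.
Local Open Scope ring_scope.

Definition ratmx (m n : nat) (M : 'M[int]_(m, n)) : 'M[rat]_(m, n) :=
  map_mx intr M.

Section DigitSystems.
Variable d : nat.
Implicit Types (P Q : 'M[int]_d) (D E X : set 'cV[rat]_d).

(** Z^d[A]; the inner set is Z^d + A Z^d + ... + A^(k-1) Z^d. *)
Definition Zadjoin (A : 'M[rat]_d) : set 'cV[rat]_d :=
  \bigcup_(k in [set k : nat | (1 <= k)%N])
    [set \sum_(i < k) A ^+ i *m ratmx (v i) | v in [set: 'I_k -> 'cV[int]_d]].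

Definition coprime_mx P Q : Prop :=
  [set P *m a + Q *m b | a in [set: 'cV[int]_d] & b in [set: 'cV[int]_d]]
  = [set: 'cV[int]_d].

(** Q^-1 P, Z^d[Q^-1 P], P Z^d[Q^-1 P] and Z^d + P Z^d[Q^-1 P], in this order.
    [invmx] is the inverse only on invertible matrices, and P and Q are always
    assumed invertible over the rationals. *)
Definition base P Q : 'M[rat]_d := invmx (ratmx Q) *m ratmx P.

Definition state_space P Q : set 'cV[rat]_d := Zadjoin (base P Q).

Definition P_state_space P Q : set 'cV[rat]_d :=
  [set ratmx P *m x | x in state_space P Q].

Definition digit_space P Q : set 'cV[rat]_d :=
  [set ratmx v + w | v in [set: 'cV[int]_d] & w in P_state_space P Q].

Definition complete_residue_system P Q X : Prop :=
  X `<=` digit_space P Q /\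
  forall v, digit_space P Q v ->
    exists! r, X r /\ P_state_space P Q (v - r).

(** Digit functions and [Phi] are total functions on Q^d; only their values on
    [digit_space P Q] and [state_space P Q] respectively are ever used. *)
Definition digit_function P Q D (dig : 'cV[rat]_d -> 'cV[rat]_d) : Prop :=
  set_fun (digit_space P Q) D dig /\
  forall v, digit_space P Q v -> P_state_space P Q (v - dig v).

Definition Phi P Q (dig : 'cV[rat]_d -> 'cV[rat]_d) (x : 'cV[rat]_d) :
    'cV[rat]_d :=
  invmx (ratmx P) *m (ratmx Q *m x - dig (ratmx Q *m x)).

Definition absorbing P Q (f : 'cV[rat]_d -> 'cV[rat]_d) X : Prop :=
  f @` X `<=` X /\
  forall x, state_space P Q x -> exists n : nat, X (iter n f x).

Definition attractor P Q (f : 'cV[rat]_d -> 'cV[rat]_d) X : Prop :=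
  [/\ X `<=` state_space P Q,
      absorbing P Q f X
    & forall Y, Y `<` X -> ~ absorbing P Q f Y].

Definition finiteness_property P Q E : Prop :=
  forall x, state_space P Q x ->
    exists (l : nat) (e : 'I_l -> 'cV[rat]_d),
      [/\ (1 <= l)%N, forall i, E (e i)
        & x = \sum_(i < l) base P Q ^+ i *m (invmx (ratmx Q) *m e i)].

End DigitSystems.

(* Main.v *)
Require Import Defs.
From mathcomp Require Import all_boot all_order all_algebra all_field.
From mathcomp Require Import ring.
From mathcomp Require Import mathcomp_extra boolp classical_sets functions cardinality.
Set Implicit Arguments.
Unset Strict Implicit.
Unset Printing Implicit Defensive.
Import Order.TTheory GRing.Theory Num.Theory.
Local Open Scope classical_set_scope.
Local Open Scope ring_scope.

(** Write B = Q^-1 P and S = Z^d[B], filtered by the lattices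
    S_k = Z^d + B Z^d + ... + B^(k-1) Z^d. The map Phi satisfies
    x = Q^-1 d(Qx) + B Phi(x); iterating this until the orbit enters the
    attractor gives the first part, the last digit being Q Phi^n(x).

    For the second part, two facts put every orbit eventually in one finite set.
    First, Phi maps S_k into S_(k-1) as long as k exceeds some M: splitting off
    the lowest term u of x - Q^-1 d, the vector B^-1 u lies in S, and because
    only finitely many classes of u matter it lies in a fixed S_K. Second, if
    prod_i (X - m_i) is the characteristic polynomial of B, then an orbit y_n
    yields z_n = (B - m_1) y_n, again an orbit with bounded error, with
    m_1 y_(n+1) = y_n + error - z_(n+1). Since |m_1| > 1, a bound on z_n gives a
    bound on y_n, and the chain starts at 0 by Cayley-Hamilton. Hence orbits end
    up in a ball of the lattice S_M, and the periodic points form the attractor. *)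

(** * Expanding recursions over the algebraic numbers *)

Lemma eventually_le_of_affine_decay (m K : algC) : 1 < m -> 0 <= K ->
  exists2 R, 0 <= R & forall (a : nat -> algC) N0, (forall n, 0 <= a n) ->
    (forall n, (N0 <= n)%N -> a n.+1 * m <= a n + K) ->
    exists N, forall n, (N <= n)%N -> a n <= R.
Proof.
move=> m_gt1 K_ge0; have m1_gt0 : 0 < m - 1 by rewrite subr_gt0.
have m_gt0 : 0 < m by apply: lt_trans m_gt1.
(* Chosen so that m R = R + K + 1: the spare 1 lowers an excess of k over R to k - 1 in a single
   step, so finitely many steps suffice. *)
pose R := (K + 1) / (m - 1).
have R_ge0 : 0 <= R by apply: divr_ge0; [apply: addr_ge0 | apply: ltW].
exists R => [|a N0 a_ge0 decay]; first exact: R_ge0.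
have KE : K = R * (m - 1) - 1 by rewrite divfK ?gt_eqF // addrK.
have step k n : (N0 <= n)%N -> a n <= R + k%:R -> a n.+1 <= R + k.-1%:R.
  move=> le_n le_a; rewrite -(ler_pM2r m_gt0); apply: le_trans (decay n le_n) _.
  apply: le_trans (lerD le_a (lexx K)) _; rewrite KE -subr_ge0.
  case: k {le_a} => [|k] /=; first by rewrite [leRHS](_ : _ = 1) //; ring.
  rewrite -natr1 [leRHS](_ : _ = k%:R * (m - 1)); last by ring.
  by rewrite mulr_ge0 // ltW.
pose k0 := Num.bound (a N0).
have bound_a n : a (N0 + n)%N <= R + (k0 - n)%:R.
  elim: n => [|n IHn].
    by rewrite addn0 subn0 ler_wpDl // ltW // archi_boundP.
  by rewrite addnS subnS; apply: step IHn; rewrite leq_addr.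
have sum_le n : (N0 + k0 <= n)%N -> (N0 <= n)%N.
  by apply: leq_trans; rewrite leq_addr.
exists (N0 + k0)%N => n le_n; have := bound_a (n - N0)%N.
rewrite subnKC ?sum_le // (_ : (k0 - (n - N0))%N = 0%N) ?addr0 //.
by apply/eqP; rewrite subn_eq0 leq_subRL ?sum_le.
Qed.

Definition norm1 n (x : 'cV[algC]_n) : algC := \sum_i `|x i 0|.

Lemma norm1_ge0 n (x : 'cV[algC]_n) : 0 <= norm1 x.
Proof. exact: sumr_ge0. Qed.

Lemma norm10 n : norm1 (0 : 'cV[algC]_n) = 0.
Proof. by apply: big1 => i _; rewrite mxE normr0. Qed.

Lemma ler_norm1D n (x y : 'cV[algC]_n) : norm1 (x + y) <= norm1 x + norm1 y.
Proof.
by rewrite -big_split; apply: ler_sum => i _; rewrite mxE ler_normD.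
Qed.

Lemma norm1Z n c (x : 'cV[algC]_n) : norm1 (c *: x) = `|c| * norm1 x.
Proof. by rewrite mulr_sumr; apply: eq_bigr => i _; rewrite mxE normrM. Qed.

Lemma norm1N n (x : 'cV[algC]_n) : norm1 (- x) = norm1 x.
Proof. by rewrite -scaleN1r norm1Z normrN1 mul1r. Qed.

Lemma norm1_entry n (x : 'cV[algC]_n) i : `|x i 0| <= norm1 x.
Proof. by rewrite /norm1 (bigD1 i) //= lerDl sumr_ge0. Qed.

Lemma norm1_mulmx_bounded n (A : 'M[algC]_n) :
  exists2 c, 0 <= c & forall x, norm1 (A *m x) <= c * norm1 x.
Proof.
exists (\sum_i \sum_j `|A i j|) => [|x].
  by apply: sumr_ge0 => i _; apply: sumr_ge0.
rewrite mulr_suml; apply: ler_sum => i _; rewrite mxE mulr_suml.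
apply: le_trans (ler_norm_sum _ _ _) _; apply: ler_sum => j _.
by rewrite normrM ler_wpM2l ?norm1_entry.
Qed.

(** Induction on [s] peels off one linear factor at a time. [R] is chosen before [y], so that all
    orbits end in the same ball. *)
Lemma eventually_bounded_of_horner n (B : 'M[algC]_n.+1) (s : seq algC) :
  (forall m, m \in s -> 1 < `|m|) -> forall E, 0 <= E ->
  exists2 R, 0 <= R & forall y : nat -> 'cV[algC]_n.+1,
    (forall k, norm1 (B *m y k.+1 - y k) <= E) ->
    (forall k, horner_mx B (\prod_(m <- s) ('X - m%:P)) *m y k = 0) ->
    exists N, forall k, (N <= k)%N -> norm1 (y k) <= R.
Proof.
elim: s => [|m s IHs] s_gt1 E E_ge0.
  exists 0 => // y _ y0; exists 0%N => k _.
  have := y0 k; rewrite big_nil rmorph1 mul1mx => ->.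
  by rewrite norm10.
have [c c_ge0 leB] := norm1_mulmx_bounded (B - m%:M).
have [||R' R'_ge0 bnd] := IHs _ (c * E); rewrite ?mulr_ge0 //.
  by move=> i i_s; apply: s_gt1; rewrite inE i_s orbT.
have m_gt1 : 1 < `|m| by rewrite s_gt1 ?mem_head.
have [|R R_ge0 bndR] := eventually_le_of_affine_decay m_gt1 (_ : 0 <= E + R').
  by rewrite addr_ge0.
exists R => // y y_step y0.
(* This sequence is killed by the product over the remaining roots; since [B - m%:M] commutes with
   [B], its error is at most [c * E]. *)
have [||N leN] := bnd (fun k => (B - m%:M) *m y k).
- move=> k; apply: le_trans (ler_wpM2l c_ge0 (y_step k)).
  apply: le_trans (leB _); rewrite mulmxBr !mulmxA.
  by rewrite [(B - _) *m B]mulmxBl mulmxBr mul_mx_scalar mul_scalar_mx.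
- move=> k; have := y0 k; rewrite big_cons mulrC rmorphM rmorphB /=.
  by rewrite horner_mx_X horner_mx_C -[_ * _]/(_ *m _) -mulmxA.
apply: (bndR _ N) => [k|k le_k]; first exact: norm1_ge0.
rewrite mulrC -norm1Z.
have -> : m *: y k.+1 = y k + (B *m y k.+1 - y k) - (B - m%:M) *m y k.+1.
  by rewrite mulmxBl mul_scalar_mx [y k + _]addrC subrK opprB addrC subrK.
apply: le_trans (ler_norm1D _ _) _.
rewrite [leRHS]addrA norm1N lerD ?leN ?(leqW le_k) //.
by apply: le_trans (ler_norm1D _ _) _; rewrite lerD.
Qed.

Lemma eventually_bounded_of_expanding n (B : 'M[algC]_n.+1) :
  (forall z, eigenvalue B z -> 1 < `|z|) -> forall E, 0 <= E ->
  exists R, forall y : nat -> 'cV[algC]_n.+1,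
    (forall k, norm1 (B *m y k.+1 - y k) <= E) ->
    exists N, forall k, (N <= k)%N -> norm1 (y k) <= R.
Proof.
move=> B_exp E E_ge0.
have [s] := closed_field_poly_normal (char_poly B).
rewrite (eqP (char_poly_monic B)) scale1r => charE.
have [|R _ bnd] := @eventually_bounded_of_horner _ B s _ E E_ge0.
  by move=> z z_s; rewrite B_exp // eigenvalue_root_char charE root_prod_XsubC.
by exists R => y y_step; apply: bnd => // k; rewrite -charE Cayley_Hamilton mul0mx.
Qed.

(** * Common denominators and the filtration of Z^d[B] *)

Lemma rat_mx_clear_denominators m n (A : 'M[rat]_(m, n)) :
  exists (N : nat) (M : 'M[int]_(m, n)), (0 < N)%N /\ N%:R *: A = ratmx M.
Proof.
pose q (ij : 'I_m * 'I_n) := `|denq (A ij.1 ij.2)|%N.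
have q_gt0 ij : (0 < q ij)%N by rewrite absz_gt0 denq_neq0.
exists (\prod_ij q ij)%N.
exists (\matrix_(i, j) (numq (A i j) * (\prod_(ij | ij != (i, j)) q ij)%N%:Z)).
split; first exact: prodn_gt0.
apply/matrixP => i j; rewrite !mxE (bigD1 (i, j)) //= natrM rmorphM /= numqE.
by rewrite mulrAC [_ * A i j]mulrC -absz_denq.
Qed.

Lemma ratmx0 m n : ratmx (0 : 'M[int]_(m, n)) = 0.
Proof. exact: map_mx0. Qed.

Section Levels.
Variables (d : nat) (B : 'M[rat]_d).

(* Z^d + B Z^d + ... + B^(k-1) Z^d, in Horner form. *)
Fixpoint level k : set 'cV[rat]_d :=
  if k is k'.+1 then
    [set ratmx u + B *m x | u in [set: 'cV[int]_d] & x in level k']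
  else [set 0].

Lemma level0 k : level k 0.
Proof.
by elim: k => //= k IHk; exists 0 => //; exists 0; rewrite // ratmx0 mulmx0 addr0.
Qed.

Lemma levelB k x y : level k x -> level k y -> level k (x - y).
Proof.
elim: k x y => /= [|k IHk] x y; first by move=> -> ->; rewrite subrr.
move=> [u _ [x' Lx' <-]] [v _ [y' Ly' <-]].
exists (u - v) => //; exists (x' - y'); first exact: IHk.
by rewrite /ratmx map_mxB mulmxBr opprD addrACA.
Qed.

Lemma levelD k x y : level k x -> level k y -> level k (x + y).
Proof.
by move=> Lx Ly; rewrite -[y]opprK -[- y]sub0r; do !apply: levelB => //; apply: level0.
Qed.

Lemma level_widen j k x : (j <= k)%N -> level j x -> level k x.
Proof.
elim: j k x => [|j IHj] [|k] x //= le_jk; first by move=> ->; apply: (level0 k.+1).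
by move=> [u _ [x' Lx' <-]]; exists u => //; exists x' => //; apply: IHj.
Qed.

Lemma level_int k u : level k.+1 (ratmx u).
Proof.
by exists u => //; exists 0; rewrite ?mulmx0 ?addr0 //; apply: level0.
Qed.

(** Covers k = 0 as well, where 0 = 0 + B 0 and [k.-1] is again 0. *)
Lemma level_split k x :
  level k x -> exists u x', level k.-1 x' /\ x = ratmx u + B *m x'.
Proof.
case: k => [|k] /=; first by move=> ->; exists 0, 0; rewrite ratmx0 mulmx0 addr0.
by move=> [u _ [x' Lx' <-]]; exists u, x'.
Qed.

Lemma level_sum k (v : 'I_k -> 'cV[int]_d) :
  level k (\sum_(i < k) B ^+ i *m ratmx (v i)).
Proof.
elim: k v => [|k IHk] v /=; first by rewrite big_ord0.
exists (v ord0) => //.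
exists (\sum_(i < k) B ^+ i *m ratmx (v (lift ord0 i))); first exact: IHk.
rewrite big_ord_recl expr0 mul1mx mulmx_sumr; congr (_ + _).
by apply: eq_bigr => i _; rewrite lift0 exprS -mulmxE mulmxA.
Qed.

Lemma level_sumE k x : level k x ->
  exists v : 'I_k -> 'cV[int]_d, x = \sum_(i < k) B ^+ i *m ratmx (v i).
Proof.
elim: k x => [|k IHk] x /=.
  by move=> ->; exists (fun=> 0); rewrite big_ord0.
move=> [u _ [_ /IHk[v ->] <-]].
exists (fun i => if unlift ord0 i is Some j then v j else u).
rewrite big_ord_recl expr0 mul1mx mulmx_sumr unlift_none; congr (_ + _).
by apply: eq_bigr => i _; rewrite lift0 liftK exprS -mulmxE mulmxA.
Qed.

Lemma ZadjoinE x : Zadjoin B x <-> exists k, level k x.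
Proof.
split=> [[k _ [v _ <-]]|[k Lx]]; first by exists k; apply: level_sum.
have /level_sumE[v ->] : level k.+1 x by apply: level_widen Lx.
by exists k.+1 => //; exists v.
Qed.

(** One further factor, a denominator of [B], clears each new level. Hence a level lies in a lattice
    N^-1 Z^d, whose bounded parts are finite. *)
Lemma level_denominator k : exists N : nat, (0 < N)%N /\
  forall x, level k x -> exists w, N%:R *: x = ratmx w.
Proof.
have [NB [MB [NB_gt0 NBE]]] := rat_mx_clear_denominators B.
elim: k => [|k [N [N_gt0 IHk]]].
  by exists 1%N; split=> // x ->; exists 0; rewrite scaler0 ratmx0.
exists (N * NB)%N; split=> [|x /= [u _ [x' /IHk[w Nx'] <-]]].
  by rewrite muln_gt0 N_gt0.
exists ((N * NB)%:R *: u + MB *m w).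
rewrite /ratmx map_mxD map_mxZ map_mxM -/(ratmx MB) -/(ratmx w) -NBE -Nx'.
by rewrite rmorph_nat scalerDr -scalemxAl -scalemxAr scalerA -natrM mulnC.
Qed.

End Levels.

(** * Descent through the filtration *)

(* u only matters modulo a common denominator N of B^-1, since B^-1 maps
   N Z^d into Z^d. *)
Lemma inv_level_bounded d (B : 'M[rat]_d) :
  exists K, forall u : 'cV[int]_d, Zadjoin B (invmx B *m ratmx u) ->
    level B K (invmx B *m ratmx u).
Proof.
have [N [M [N_gt0 NE]]] := rat_mx_clear_denominators (invmx B).
pose lev (r : 'cV['I_N]_d) : 'cV[rat]_d :=
  invmx B *m ratmx (map_mx (fun i : 'I_N => (i : nat)%:Z) r).
have /choice[K KP] : forall r, exists K, Zadjoin B (lev r) -> level B K (lev r).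
  move=> r; case: (pselect (Zadjoin B (lev r))) => [/ZadjoinE[k Lk]|nS].
    by exists k.
  by exists 0%N.
(* With u = N t + r, the part N B^-1 t = M t is integral and needs level 1; the maximum runs over
   the finitely many residues r. *)
exists (maxn 1 (\max_r K r)) => u.
have modP i : (`|(u i ord0 %% N)%Z|%N < N)%N.
  by rewrite -ltz_nat gez0_abs ?modz_ge0 ?ltz_pmod // ?gt_eqF // ltz_nat.
pose r : 'cV['I_N]_d := \col_i Ordinal (modP i).
pose t : 'cV[int]_d := \col_i (u i ord0 %/ N)%Z.
have -> : invmx B *m ratmx u = ratmx (M *m t) + lev r.
  rewrite {2}/ratmx map_mxM -!/(ratmx _) -NE -scalemxAl scalemxAr -mulmxDr.
  congr (_ *m _); apply/colP => i; rewrite !mxE.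
  rewrite gez0_abs ?modz_ge0 ?gt_eqF ?ltz_nat // {1}(divz_eq (u i ord0) N).
  by rewrite rmorphD rmorphM /= mulrC.
have L1 := level_int B 0 (M *m t).
move=> /ZadjoinE[k Lk].
apply: levelD; first by apply: level_widen L1; rewrite leq_maxl.
apply: (@level_widen _ _ (K r)).
  by rewrite leq_max; apply/orP; right; apply: leq_bigmax.
(* [lev r] differs by an integral vector from B^-1 u, which lies in Z^d[B] by assumption. *)
apply: KP; apply/ZadjoinE; exists (maxn 1 k).
rewrite -[lev r](addKr (ratmx (M *m t))) addrC.
by apply: levelB; [apply: level_widen Lk | apply: level_widen L1];
  rewrite ?leq_maxl ?leq_maxr.
Qed.

Lemma finite_uniform_level d (B : 'M[rat]_d) (T : set 'cV[rat]_d) :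
  finite_set T -> T `<=` Zadjoin B -> exists m, T `<=` level B m.
Proof.
move=> /finite_seqP[s ->] sub.
elim: s sub => [|x s IHs] sub; first by exists 0%N.
have [|m Lm] := IHs; first by move=> y /= ys; apply: sub; rewrite /= inE ys orbT.
have /ZadjoinE[k Lk] : Zadjoin B x by apply: sub; rewrite /= mem_head.
exists (maxn k m) => y /=; rewrite inE => /orP[/eqP->|ys].
  by apply: level_widen Lk; rewrite leq_maxl.
by apply: (@level_widen _ _ m); rewrite ?leq_maxr //; apply: Lm.
Qed.

(** [T] stands for the vectors Q^-1 d with d a digit, and y for the successor of x. At k = 0 the
    statement says that level M is preserved. *)
Lemma level_descent d (B : 'M[rat]_d) (T : set 'cV[rat]_d) :
  B \in unitmx -> finite_set T -> T `<=` Zadjoin B ->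
  exists M, forall k x y, level B (M + k) x -> Zadjoin B y -> T (x - B *m y) ->
    level B (M + k.-1) y.
Proof.
move=> B_unit Tfin Tsub; have [m Lm] := finite_uniform_level Tfin Tsub.
have [K LK] := inv_level_bounded B.
(* M >= m keeps x - t in the level of x for t in [T]; M >= K leaves room for B^-1 u below. *)
exists (maxn m K) => k x y Lx Sy /Lm Lt.
have : level B (maxn m K + k) (B *m y).
  rewrite -(subKr x (B *m y)); apply: levelB => //; apply: level_widen Lt.
  by rewrite (leq_trans (leq_maxl m K)) ?leq_addr.
move=> /level_split[u [y' [Ly' Byy']]].
have yE : y = invmx B *m ratmx u + y'.
  by rewrite -[y'](mulKmx B_unit) -mulmxDr -Byy' mulKmx.
rewrite yE; apply: levelD; last first.
  by apply: level_widen Ly'; case: (k) => [|j]; rewrite ?addnS //= addn0 leq_pred.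
apply: (@level_widen _ _ K); first by rewrite (leq_trans (leq_maxr m K)) ?leq_addr.
(* B^-1 u = y - y' is a difference of elements of Z^d[B], as [LK] requires. *)
apply: LK; move/ZadjoinE: Sy => [j Lj]; apply/ZadjoinE.
exists (maxn j (maxn m K + k).-1); rewrite -[X in level _ _ X](addrK y') -yE.
by apply: levelB; [apply: level_widen Lj | apply: level_widen Ly'];
  rewrite ?leq_maxl ?leq_maxr.
Qed.

(** * Finiteness of the eventual range of orbits *)

Lemma finite_bounded_lattice d (N : nat) (R : algC) : (0 < N)%N ->
  finite_set [set x : 'cV[rat]_d |
    (exists w, N%:R *: x = ratmx w) /\ norm1 (map_mx ratr x) <= R].
Proof.
(* The entries of N x are integers of modulus at most b; shifted by b, they are encoded in
   ['I_(b.*2.+1)]. *)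
move=> N_gt0; pose b := Num.bound (N%:R * R).
pose f (u : 'cV['I_(b.*2.+1)]_d) : 'cV[rat]_d :=
  N%:R^-1 *: ratmx (map_mx (fun i : 'I_ _ => (i : nat)%:Z - b%:Z) u).
apply: (@sub_finite_set _ _ (f @` setT)); last first.
  exact/finite_image/finite_finset.
move=> x /= [[w Nx] xR].
have w_le i : `|w i ord0| <= b%:Z.
  rewrite -(ler_int algC) intr_norm; apply: ltW.
  have wE : (w i ord0)%:~R = N%:R * ratr (x i ord0) :> algC.
    have /colP/(_ i) := Nx; rewrite !mxE => /(congr1 (@ratr algC)).
    by rewrite rmorphM /= ratr_nat ratr_int => <-.
  have NR : `|(w i ord0)%:~R : algC| <= N%:R * R.
    rewrite wE normrM normr_nat ler_wpM2l // (le_trans _ xR) //.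
    by have := norm1_entry (map_mx ratr x) i; rewrite mxE.
  by apply: (le_lt_trans NR); apply: archi_boundP; apply: le_trans NR.
have wP i : (`|(w i ord0 + b%:Z)%R|%N < b.*2.+1)%N.
  have := w_le i; rewrite ler_norml => /andP[lo hi].
  rewrite ltnS -lez_nat gez0_abs; last by rewrite -lerBlDr sub0r.
  by rewrite -addnn PoszD lerD2r.
exists (\col_i Ordinal (wP i)) => //.
rewrite /f [X in ratmx X](_ : _ = w).
  by rewrite -Nx scalerA mulVf ?scale1r // pnatr_eq0 -lt0n.
apply/colP => i; rewrite !mxE /= gez0_abs ?addrK //.
by have := w_le i; rewrite ler_norml -lerBlDr sub0r => /andP[].
Qed.

Lemma iter_eventually_finite d (B : 'M[rat]_d.+1) (T : set 'cV[rat]_d.+1)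
    (f : 'cV[rat]_d.+1 -> 'cV[rat]_d.+1) :
  (forall z : algC, eigenvalue (map_mx ratr B) z -> 1 < `|z|) ->
  B \in unitmx -> finite_set T -> T `<=` Zadjoin B ->
  (forall x, Zadjoin B x -> Zadjoin B (f x) /\ T (x - B *m f x)) ->
  exists2 F, finite_set F &
    forall x, Zadjoin B x -> exists N, forall n, (N <= n)%N -> F (iter n f x).
Proof.
move=> B_exp B_unit Tfin Tsub fP.
have [M descent] := level_descent B_unit Tfin Tsub.
have [N [N_gt0 denom]] := level_denominator B M.
have [E E_ge0 leE] : exists2 E, 0 <= E &
    forall t, T t -> norm1 (map_mx ratr t) <= E.
  case/finite_seqP: Tfin => s Ts.
  exists (\sum_(t <- s) norm1 (map_mx ratr t)) => [|t].
    by apply: sumr_ge0 => t _; apply: norm1_ge0.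
  rewrite Ts /= => t_s; rewrite (big_rem t) //= lerDl.
  by apply: sumr_ge0 => i _; apply: norm1_ge0.
have [R bnd] := eventually_bounded_of_expanding B_exp E_ge0.
exists [set x | (exists w, N%:R *: x = ratmx w) /\ norm1 (map_mx ratr x) <= R].
  exact: finite_bounded_lattice.
move=> x Sx; have Siter n : Zadjoin B (iter n f x).
  by elim: n => //= n IHn; have [] := fP _ IHn.
have [n1 len1] : exists n1, forall n, (n1 <= n)%N ->
    norm1 (map_mx ratr (iter n f x)) <= R.
  apply: (bnd (fun n => map_mx ratr (iter n f x))) => k.
  rewrite -norm1N opprB -map_mxM -map_mxB; apply: leE.
  by have [] := fP _ (Siter k).
move/ZadjoinE: (Sx) => [k0 Lk0].
(* The excess over level M drops by one per step, and truncated subtraction holds it at 0 from time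
   [k0] on. *)
have Liter n : level B (M + (k0 - n)) (iter n f x).
  elim: n => [|n IHn].
    by rewrite subn0; apply: level_widen Lk0; rewrite leq_addl.
  have [Sf Tf] := fP _ (Siter n).
  by rewrite subnS /=; apply: descent IHn Sf Tf.
exists (maxn n1 k0) => n; rewrite geq_max => /andP[le1 le0]; split; last exact: len1.
apply: denom; have := Liter n.
by rewrite (_ : (k0 - n)%N = 0%N) ?addn0 //; apply/eqP.
Qed.

(** * Periodic points as the attractor *)

Lemma finite_eventual_repeat T (F : set T) (a : nat -> T) N :
  finite_set F -> (forall n, (N <= n)%N -> F (a n)) ->
  exists i j, (i < j)%N /\ a i = a j.
Proof.
move=> Ffin aF; apply: contrapT => no_repeat.
have a_inj i j : a i = a j -> i = j.
  move=> aij; apply: contrapT => /eqP; rewrite neq_ltn => /orP[lt|lt];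
    apply: no_repeat; first by exists i, j.
  by exists j, i.
apply: infinite_nat.
apply: (@sub_finite_set _ _ ((fun n => a (N + n)%N) @^-1` F)).
  by move=> n _; apply: aF; rewrite leq_addr.
by apply: finite_preimage => // i j _ _ /a_inj /addnI.
Qed.

(** Periodic points recur, so they lie in [F] and in every absorbing set; by pigeonhole every orbit
    reaches one. *)
Lemma attractor_of_eventually_finite d (P Q : 'M[int]_d)
    (f : 'cV[rat]_d -> 'cV[rat]_d) (F : set 'cV[rat]_d) :
  (forall x, state_space P Q x -> state_space P Q (f x)) -> finite_set F ->
  (forall x, state_space P Q x ->
     exists N, forall n, (N <= n)%N -> F (iter n f x)) ->
  exists2 A, attractor P Q f A & finite_set A.
Proof.
move=> fS Ffin ev.
have Siter n x : state_space P Q x -> state_space P Q (iter n f x).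
  by move=> Sx; elim: n => //= n; apply: fS.
exists [set x | state_space P Q x /\
  exists2 p, (0 < p)%N & iter p f x = x]; last first.
  apply: sub_finite_set Ffin => x [Sx [p p_gt0 px]].
  (* N p is a multiple of the period and at least N. *)
  have [N FN] := ev x Sx; rewrite -[x](_ : iter (N * p) f x = x).
    by apply: FN; rewrite leq_pmulr.
  by rewrite iterM; apply: iter_fix.
split=> [x []//| |Y [YA AY] [fY absY]].
  split=> [_ [x [Sx [p p_gt0 px]] <-]|x Sx].
    by split; [apply: fS | exists p => //; rewrite -iterSr iterS px].
  have [N FN] := ev x Sx.
  have [i [j [lt_ij ij]]] := finite_eventual_repeat Ffin FN.
  exists i; split; first exact: Siter.
  exists (j - i)%N; first by rewrite subn_gt0.
  by rewrite -iterD subnK // ltnW.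
apply: AY => x [Sx [p p_gt0 px]].
have [n Yn] := absY x Sx.
have Yiter k : Y (iter (k + n) f x).
  by elim: k => // k IHk; apply: fY; exists (iter (k + n) f x).
(* The orbit stays in [Y] from time n on, and at time n p >= n it is back at x. *)
rewrite -[x](_ : iter (n * p) f x = x); last by rewrite iterM; apply: iter_fix.
by rewrite -(subnK (leq_pmulr n p_gt0)).
Qed.

(** * The map [Phi] and its digit expansions *)

Section Transition.
Variables (d : nat) (P Q : 'M[int]_d) (D : set 'cV[rat]_d).
Variable dig : 'cV[rat]_d -> 'cV[rat]_d.
Hypotheses (P_unit : ratmx P \in unitmx) (Q_unit : ratmx Q \in unitmx).

Lemma unitmx_base : base P Q \in unitmx.
Proof. by rewrite unitmx_mul unitmx_inv Q_unit. Qed.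

Lemma mulmx_Q_base (x : 'cV[rat]_d) : ratmx Q *m (base P Q *m x) = ratmx P *m x.
Proof. by rewrite -mulmxA mulKVmx. Qed.

(** Q B = P gives Q (u + B y) = Q u + P y. *)
Lemma digit_space_mulQ x : state_space P Q x -> digit_space P Q (ratmx Q *m x).
Proof.
move=> /ZadjoinE[k /level_split[u [y [Ly ->]]]].
rewrite mulmxDr mulmx_Q_base -map_mxM; exists (Q *m u) => //.
by exists (ratmx P *m y) => //; exists y => //; apply/ZadjoinE; exists k.-1.
Qed.

(** Coprimality writes w = P a + Q b, whence Q^-1 (w + P x) = b + B (a + x). This places Q^-1 d in
    the state space for every digit d. *)
Lemma state_space_invQ v : coprime_mx P Q ->
  digit_space P Q v -> state_space P Q (invmx (ratmx Q) *m v).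
Proof.
move=> coPQ [w _ [_ [x /ZadjoinE[k Lx] <-] <-]].
have : [set: 'cV[int]_d] w by [].
rewrite -coPQ => -[a _ [b _ <-]]; apply/ZadjoinE; exists k.+2.
exists b => //; exists (ratmx a + x).
  by apply: levelD; [apply: level_int | apply: level_widen Lx].
by rewrite /ratmx map_mxD !map_mxM !mulmxDr mulKmx // /base -!mulmxA addrCA addrA.
Qed.

Hypothesis dig_fun : digit_function P Q D dig.

Lemma Phi_state x : state_space P Q x -> state_space P Q (Phi P Q dig x).
Proof.
move=> /digit_space_mulQ/(proj2 dig_fun)[y Sy yE].
by rewrite /Phi -yE mulKmx.
Qed.

Lemma base_Phi x :
  x = invmx (ratmx Q) *m dig (ratmx Q *m x) + base P Q *m Phi P Q dig x.
Proof. by rewrite /Phi -mulmxA mulKVmx // mulmxBr mulKmx // addrC subrK. Qed.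

Lemma iter_Phi n x :
  x = \sum_(i < n) base P Q ^+ i *m
        (invmx (ratmx Q) *m dig (ratmx Q *m iter i (Phi P Q dig) x))
      + base P Q ^+ n *m iter n (Phi P Q dig) x.
Proof.
elim: n => [|n {1}->]; first by rewrite big_ord0 add0r mul1mx.
rewrite big_ord_recr /= -addrA; congr (_ + _).
rewrite {1}[iter n _ x]base_Phi mulmxDr exprSr -mulmxE !mulmxA.
by [].
Qed.

End Transition.

Theorem proposition4 (d : nat) (d_ge1 : (1 <= d)%N) (P Q : 'M[int]_d)
    (P_unit : ratmx P \in unitmx) (Q_unit : ratmx Q \in unitmx)
    (PQ_coprime : coprime_mx P Q)
    (D : set 'cV[rat]_d)
    (D_sub : D `<=` digit_space P Q) (D_fin : finite_set D)
    (D_res : exists2 X, X `<=` D & complete_residue_system P Q X)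
    (dig : 'cV[rat]_d -> 'cV[rat]_d) (dig_fun : digit_function P Q D dig) :
  (forall A : set 'cV[rat]_d,
     attractor P Q (Phi P Q dig) A -> finite_set A ->
     finiteness_property P Q (D `|` [set ratmx Q *m a | a in A]))
  /\
  ((forall z : algC, eigenvalue (map_mx ratr (base P Q)) z -> 1 < `|z|) ->
   exists2 A : set 'cV[rat]_d, attractor P Q (Phi P Q dig) A & finite_set A).
Proof.
have dig_in x : state_space P Q x -> D (dig (ratmx Q *m x)).
  by move=> Sx; apply: (proj1 dig_fun); apply: digit_space_mulQ.
have Siter n x : state_space P Q x -> state_space P Q (iter n (Phi P Q dig) x).
  by move=> Sx; elim: n => //= n; apply: Phi_state P_unit Q_unit dig_fun _.
split=> [A [_ [_ absA] _] _ x Sx|B_exp].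
  have [n An] := absA x Sx.
  (* The first n digits are those of the orbit; the last, Q Phi^n(x), encodes the remainder, so the
     length is at least 1 even for n = 0. *)
  exists n.+1, (fun i => if (i < n)%N then dig (ratmx Q *m iter i (Phi P Q dig) x)
                         else ratmx Q *m iter n (Phi P Q dig) x).
  split=> // [i|].
    by case: ifP => _; [left; apply/dig_in/Siter | right; exists (iter n (Phi P Q dig) x)].
  rewrite {1}(iter_Phi dig P_unit Q_unit n x) big_ord_recr /= ltnn mulKmx //.
  by congr (_ + _); apply: eq_bigr => i _; rewrite ltn_ord.
(* Dimension 0 contradicts [d_ge1]; the expansion argument is stated for size [d.+1]. *)
destruct d as [|d]; first by [].
have [||F Ffin Fev] := iter_eventually_finite (f := Phi P Q dig) B_exp
  (unitmx_base P_unit Q_unit) (finite_image (mulmx (invmx (ratmx Q))) D_fin).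
- by move=> _ [t /D_sub Dt <-]; apply: state_space_invQ.
- move=> x Sx; split; first exact: Phi_state P_unit Q_unit dig_fun _ Sx.
  exists (dig (ratmx Q *m x)); first exact: dig_in.
  by rewrite {2}(base_Phi dig P_unit Q_unit x) addrK.
apply: attractor_of_eventually_finite Ffin Fev => x.
exact: Phi_state P_unit Q_unit dig_fun _.
Qed.
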